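(* Let $T$ be a tree with $n\ge 1$ vertices. Then the polytope $P_{n-1}(T)$ is unimodularly equivalent to $[0,1]^{n-1}\times\{0\}\subset\mathbb{R}^n$; that is, there exist $U\in \mathrm{SL}_n(\mathbb{Z})$ and $b\in\mathbb{Z}^n$ with $[0,1]^{n-1}\times\{0\}=U\,P_{n-1}(T)+b$.
   Context: Label the vertices $v_1,\dots,v_n$. A chip configuration on $T$ is a vector $c\in\mathbb{Z}_{\ge 0}^n$ ($c_i$ chips on $v_i$). The Laplacian $\Delta(T)$ has $\Delta_{ii}=\deg(v_i)$, $\Delta_{ij}=-1$ if $v_iv_j$ is an edge, $0$ otherwise. Firing $v_i$ from $c$ produces $c-\Delta(T)e_i$, legal if $c_i\ge\deg(v_i)$. A configuration $c$ is self-reachable on $T$ if some nonempty finite sequence of legal firings starting from $c$ ends at $c$. (Known: equivalently, $c$ has at least $m-1$ chips on every $m$-vertex subtree of $T$.) $S_\ell^{(T)}$ is the set of self-reachable configurations on $T$ with exactly $\ell$ chips, and $P_\ell(T)=\mathrm{conv}(S_\ell^{(T)})\subset\mathbb{R}^n$. *)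

(* Defs.v *)
From mathcomp Require Import all_boot all_order all_algebra.
From mathcomp Require Import all_classical all_reals all_analysis.

Set Implicit Arguments.
Unset Strict Implicit.
Unset Printing Implicit Defensive.

Import Order.TTheory GRing.Theory Num.Theory.

Local Open Scope classical_set_scope.
Local Open Scope ring_scope.

(* A graph on the labelled vertices v_1, ..., v_n is given by its adjacency
   relation on 'I_n. *)

Definition simple_graph (n : nat) (e : rel 'I_n) : Prop :=
  symmetric e /\ irreflexive e.

Definition connected_graph (n : nat) (e : rel 'I_n) : Prop :=
  forall i j : 'I_n, connect e i j.

(* [ucycle e p] also holds when p is empty, and when p = [:: i; j] for an
   edge ij; graph-theoretic cycles are those of length at least 3. *)
Definition acyclic_graph (n : nat) (e : rel 'I_n) : Prop :=
  forall p : seq 'I_n, ucycle e p -> (size p < 3)%N.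

Definition is_tree (n : nat) (e : rel 'I_n) : Prop :=
  [/\ simple_graph e, connected_graph e & acyclic_graph e].

Definition degree (n : nat) (e : rel 'I_n) (i : 'I_n) : nat :=
  #|[set j : 'I_n | e i j]%SET|.

Definition laplacian (n : nat) (e : rel 'I_n) : 'M[int]_n :=
  \matrix_(i, j) (if i == j then (degree e i)%:Z
                  else if e i j then -1 else 0).

Definition chip_configuration (n : nat) (c : 'cV[int]_n) : Prop :=
  forall i, 0 <= c i 0.

Definition fire (n : nat) (e : rel 'I_n) (c : 'cV[int]_n) (i : 'I_n) :
  'cV[int]_n := c - laplacian e *m delta_mx i 0.

Definition legal (n : nat) (e : rel 'I_n) (c : 'cV[int]_n) (i : 'I_n) : bool :=
  (degree e i)%:Z <= c i 0.

Fixpoint legal_sequence (n : nat) (e : rel 'I_n) (c : 'cV[int]_n)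
    (s : seq 'I_n) : bool :=
  if s is i :: s' then legal e c i && legal_sequence e (fire e c i) s'
  else true.

Definition self_reachable (n : nat) (e : rel 'I_n) (c : 'cV[int]_n) : Prop :=
  exists s : seq 'I_n,
    [/\ s <> [::], legal_sequence e c s & foldl (fire e) c s = c].

Definition self_reachable_set (n : nat) (e : rel 'I_n) (l : nat) :
  set 'cV[int]_n :=
  [set c | [/\ chip_configuration c, self_reachable e c
             & \sum_i c i 0 = l%:Z]].

Definition convex_hull (R : realType) (n : nat) (A : set 'cV[R]_n) :
  set 'cV[R]_n := smallest (@convex_set R 'cV[R]_n) A.

Definition self_reachable_polytope (R : realType) (n : nat) (e : rel 'I_n)
    (l : nat) : set 'cV[R]_n :=
  convex_hull (map_mx intr @` self_reachable_set e l).
Arguments self_reachable_polytope R [n] e l.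

(* [0,1]^(n-1) x {0}, for n > 0; the last coordinate has index n.-1. *)
Definition cube_times_zero (R : realType) (n : nat) : set 'cV[R]_n :=
  [set x | forall i : 'I_n,
     ((i < n.-1)%N -> 0 <= x i 0 <= 1) /\ (i = n.-1 :> nat -> x i 0 = 0)].
Arguments cube_times_zero : clear implicits.

(* Main.v *)
(* Suppose that a legal sequence of firings returns to c. Since the kernel of
   the Laplacian consists of constants, every vertex fires; order the vertices
   by their last firing. Then c dominates the indegree vector of the acyclic
   orientation of the tree given by this order, and with n - 1 chips it is equal
   to it. Conversely, firing the vertices in the order of an acyclic orientation,
   sinks first, is legal and returns to the indegree vector. So the
   self-reachable configurations with n - 1 chips are the indegree vectors of
   the orientations of the tree. Root the tree at r, with parent map p. Since
   each edge {w, p w} may be oriented independently, these vectors are k + B x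
   with x in {0,1}^(n-1) x {0}, where column w of B is e_w - e_(p w) (e_r for
   w = r). The inverse of B is the integer matrix whose (v, w) entry is 1 when v
   is an ancestor of w. *)

Require Import Defs.
From mathcomp Require Import all_boot all_order all_algebra.
From mathcomp Require Import all_classical all_reals all_analysis.
From mathcomp Require Import unstable zify.

Set Implicit Arguments.
Unset Strict Implicit.
Unset Printing Implicit Defensive.

Import Order.TTheory GRing.Theory Num.Theory.

Local Open Scope classical_set_scope.
Local Open Scope ring_scope.

(** * Rooting a tree *)

(** The root is a fixed point of [p], so [fconnect p w v] says that [v] is [w] or an ancestor of
    [w]; the rank [d] excludes longer cycles of [p]. *)
Definition rooted_at (n : nat) (e : rel 'I_n) (r : 'I_n) (p : 'I_n -> 'I_n)
    (d : 'I_n -> nat) : Prop :=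
  [/\ p r = r, (forall v, v != r -> (d (p v) < d v)%N)
    & forall u v, e u v = (u != r) && (p u == v) || (v != r) && (p v == u)].

(** The second vertex of a shortest path to [r] serves as parent, with [d] the distance to [r]. *)
Lemma connected_parent (n : nat) (e : rel 'I_n) (r : 'I_n) :
  connected_graph e ->
  exists (p : 'I_n -> 'I_n) (d : 'I_n -> nat),
    forall v, v != r -> e v (p v) /\ (d (p v) < d v)%N.
Proof.
move=> conn.
pose P v k := `[< exists q, [/\ size q = k, path e v q & last v q = r] >].
have exP v : exists k, P v k.
  have /connectP[q pq lq] := conn v r.
  by exists (size q); apply/asboolP; exists q.
pose d v := ex_minn (exP v).
suff next v : exists w, v != r -> e v w /\ (d w < d v)%N.
  by have [p pP] := boolp.choice next; exists p, d.
have [->|vr] := eqVneq v r; first by exists r.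
rewrite {2}/d; case: ex_minnP => k /asboolP[[|w q] [sq pq lq]] _.
  by move: vr; rewrite -lq eqxx.
exists w => _; move: pq => /= /andP[evw pq]; split=> //.
rewrite /d; case: ex_minnP => m _ /(_ (size q)); rewrite -sq /= ltnS; apply.
by apply/asboolP; exists q.
Qed.

(** A path from [u] to [v] avoiding the edge could be made simple, and the edge would close it to a
    cycle; acyclicity leaves only a loop or the edge itself. *)
Lemma acyclic_bridge (n : nat) (e : rel 'I_n) (u v : 'I_n) :
  simple_graph e -> acyclic_graph e -> e u v ->
  ~~ connect [rel x y | e x y && ([set x; y] != [set u; v])%SET] u v.
Proof.
move=> [sym irr] acyc euv; apply/negP => /connectP[q pq lq].
case/shortenP: pq lq => q' pq' uq' _ lq'.
suff: (size (u :: q') < 3)%N.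
  case: q' pq' lq' {uq'} => [|x [|]] //=.
    by move=> _ vu; rewrite vu irr in euv.
  by move=> /andP[/andP[_ /negP xv] _] vx; case: xv; rewrite vx.
apply: acyc; rewrite /ucycle uq' andbT /= rcons_path -lq' sym euv andbT.
by apply: sub_path pq' => x y /= /andP[].
Qed.

(** If an edge [uv] joined no vertex to its parent, deleting it would break no path of parents; both
    ends would still reach [r], against [acyclic_bridge]. *)
Lemma tree_rooted (n : nat) (e : rel 'I_n) (r : 'I_n) :
  is_tree e -> exists p d, rooted_at e r p d.
Proof.
move=> [[sym irr] conn acyc]; have [p [d pd]] := connected_parent r conn.
pose p' v := if v == r then r else p v.
exists p', d; split=> [|v vr|u v]; first by rewrite /p' eqxx.
  by rewrite /p' (negPf vr); case: (pd v vr).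
apply/idP/idP; last first.
  rewrite /p'; case/orP => /andP[ne]; rewrite (negPf ne) => /eqP <-.
    by case: (pd _ ne).
  by rewrite sym; case: (pd _ ne).
move=> euv; apply/negPn/negP; rewrite negb_or => /andP[up vp].
have := acyclic_bridge (conj sym irr) acyc euv; set e' := (X in connect X).
have sym' : symmetric e' by move=> x y; rewrite /e' /= sym finset.setUC.
have toroot m x : (d x <= m)%N -> connect e' x r.
  elim: m x => [|m IHm] x dx; have [->|xr] := eqVneq x r; rewrite ?connect0 //.
    by case: (pd x xr) => _; rewrite ltnNge (leq_trans dx).
  have [exp ltd] := pd x xr.
  apply: (@connect_trans _ _ (p x)); last first.
    by apply: IHm; rewrite -ltnS (leq_trans ltd).
  apply: connect1; rewrite /e' /= exp /=; apply/negP => /eqP/setP eqs.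
  have : (x \in [set u; v]%SET) && (p x \in [set u; v]%SET).
    by rewrite -!eqs !inE !eqxx orbT.
  rewrite !inE => /andP[/orP[]/eqP xE /orP[]/eqP pxE].
  - by move: ltd; rewrite pxE xE ltnn.
  - by move: up; rewrite /p' -xE (negPf xr) pxE eqxx.
  - by move: vp; rewrite /p' -xE (negPf xr) pxE eqxx.
  - by move: ltd; rewrite pxE xE ltnn.
apply/negP/negPn/(connect_trans (toroot _ u (leqnn _))).
by rewrite (sym_connect_sym sym') (toroot _ v (leqnn _)).
Qed.

Lemma rooted_fconnectE (n : nat) (e : rel 'I_n) r p d (w v : 'I_n) :
  rooted_at e r p d ->
  fconnect p w v = (w == v) || (w != r) && fconnect p (p w) v.
Proof.
move=> [pr _ _]; rewrite fconnect_eqVf; have [->|//] := eqVneq w r.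
rewrite pr /= orbF; apply/orb_idr => /iter_findex <-.
by rewrite iter_fix.
Qed.

(** Iterating [p] never increases [d], while [d (p w) < d w]. *)
Lemma rooted_fconnect_parentF (n : nat) (e : rel 'I_n) r p d (w : 'I_n) :
  rooted_at e r p d -> w != r -> fconnect p (p w) w = false.
Proof.
move=> [pr pd _] wr; apply/negP => /iter_findex Ew.
have le k x : (d (iter k p x) <= d x)%N.
  elim: k => //= k; apply: leq_trans.
  by have [->|/pd/ltnW//] := eqVneq (iter k p x) r; rewrite pr.
by have := le (findex p (p w) w) (p w); rewrite Ew leqNgt pd.
Qed.

(** * Firing sequences and indegree vectors *)

(** The orientation is encoded by heights, each edge pointing to its higher end. An edge with tied
    ends counts at neither, hence the later hypotheses [h u != h v]. *)
Definition indegree (n : nat) (e : rel 'I_n) (h : 'I_n -> int) : 'cV[int]_n :=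
  \col_v (\sum_u (e v u && (h u < h v)%R : nat))%:Z.

Lemma degreeE (n : nat) (e : rel 'I_n) (i : 'I_n) :
  degree e i = (\sum_j (e i j : nat))%N.
Proof.
rewrite /degree cardsE -sum1_card big_mkcond; apply: eq_bigr => j _.
by rewrite unfold_in; case: (e i j).
Qed.

Lemma fireE (n : nat) (e : rel 'I_n) (c : 'cV[int]_n) (i k : 'I_n) :
  irreflexive e ->
  fire e c i k 0 =
    c k 0 - (if k == i then (degree e k)%:Z else 0) + (e k i)%:Z.
Proof.
move=> irr; rewrite /fire -colE !mxE; have [->|_] := eqVneq k i.
  by rewrite irr addr0.
by case: (e k i); rewrite ?opprK ?oppr0 ?addr0.
Qed.

Lemma foldl_fireE (n : nat) (e : rel 'I_n) (c : 'cV[int]_n) (s : seq 'I_n)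
    (k : 'I_n) :
  irreflexive e ->
  foldl (fire e) c s k 0 =
    c k 0 - (degree e k * count_mem k s)%:Z + (count (e k) s)%:Z.
Proof.
move=> irr; elim: s c => [|i s IHs] c /=; first by rewrite muln0 subr0 addr0.
by rewrite IHs fireE // (eq_sym i); case: eqVneq => _ /=; case: (e k i) => /=; lia.
Qed.

(** A vertex that never fires loses no chip, so to end unchanged it must receive none: its
    neighbours never fire either, and connectedness spreads this to every vertex. *)
Lemma recurrent_fires_all (n : nat) (e : rel 'I_n) (c : 'cV[int]_n)
    (s : seq 'I_n) :
  simple_graph e -> connected_graph e -> s <> [::] -> foldl (fire e) c s = c ->
  forall i, i \in s.
Proof.
move=> [sym irr] conn s0 fs.
have nbr i j : e i j -> i \notin s -> j \notin s.
  move=> eij /count_memPn is0; have := foldl_fireE c s i irr.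
  rewrite fs is0 muln0 subr0 => /eqP; rewrite -subr_eq0 opprD addNKr oppr_eq0.
  rewrite eqz_nat -leqn0 leqNgt -has_count => /hasPn/(_ j) Nej.
  by apply/negP => /Nej; rewrite eij.
move=> i; apply/negPn/negP => iNs; case: s s0 fs nbr iNs => // j s _ _ nbr iNs.
suff: j \notin j :: s by rewrite inE eqxx.
case/connectP: (conn i j) => q; elim: q i iNs => [|k q IHq] i iNs /=.
  by move=> _ {1}->.
by case/andP => /nbr/(_ iNs); apply: IHq.
Qed.

Lemma legal_sequence_rcons (n : nat) (e : rel 'I_n) (c : 'cV[int]_n) s i :
  legal_sequence e c (rcons s i) =
  legal_sequence e c s && legal e (foldl (fire e) c s) i.
Proof. by elim: s c => [|j s IHs] c /=; rewrite ?andbT // IHs andbA. Qed.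

(* After its last firing a vertex keeps every chip it receives, so it ends with
   at least one chip for each neighbour whose last firing comes later. *)
Lemma last_firing_le (n : nat) (e : rel 'I_n) (c : 'cV[int]_n) (s : seq 'I_n) v :
  simple_graph e -> chip_configuration c -> legal_sequence e c s ->
  indegree e (fun i => (index i (rev s))%:Z) v 0 <= foldl (fire e) c s v 0.
Proof.
move=> [sym irr] c0; rewrite mxE; elim/last_ind: s => [_|s i IHs].
  by rewrite /= big1 ?c0 // => u _; rewrite ltxx andbF.
rewrite legal_sequence_rcons rev_rcons foldl_rcons fireE // => /andP[leg legi].
have {IHs} := IHs leg; move: legi; rewrite /legal.
set c' := foldl _ _ _ => legi IHs /=.
(* The vertex that has just fired has index 0, so its indegree is 0 and legality suffices. *)
have [vi|vi] := eqVneq v i.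
  rewrite big1 ?vi => [|u _]; first by rewrite addr_ge0 // subr_ge0.
  by rewrite ltz_nat ltn0 andbF.
(* For other vertices all indices shift by one, so only the comparison with [i] can change, and the
   chip sent by [i] pays for it. *)
rewrite subr0; apply: (le_trans (y := _ + (e v i)%:Z)); last first.
  by rewrite lerD2r; exact: IHs.
rewrite -PoszD lez_nat (bigD1 i) //= [in leqRHS](bigD1 i) //= eqxx.
rewrite [in leqRHS]addnC addnA leq_add //.
  by case: (e v i) => //; case: (_ < _).
apply: leq_sum => u ui; rewrite eq_sym (negPf ui).
by rewrite !ltz_nat ltnS.
Qed.

(** The count is the number of chips still to come from higher neighbours, all fired before [i].
    Each such firing trades one unit of the count for a chip; at the head of the list the count is 0
    and the bound is legality. *)
Lemma legal_sorted (n : nat) (e : rel 'I_n) (h : 'I_n -> int) (c : 'cV[int]_n)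
    (s : seq 'I_n) :
  irreflexive e -> uniq s -> sorted (fun i j => h j <= h i) s ->
  {in s, forall i,
    (degree e i)%:Z <= c i 0 + (count (fun j => e i j && (h i < h j)) s)%:Z} ->
  legal_sequence e c s.
Proof.
move=> irr; elim: s c => //= i s IHs c /andP[iNs us] pth ge.
have max j : j \in s -> h j <= h i.
  have /order_path_min := pth; move/(_ (fun _ _ _ A B => le_trans B A))/allP.
  exact.
apply/andP; split.
  have := ge i (mem_head _ _); rewrite irr /= add0n.
  rewrite (eq_in_count (a2 := pred0)) ?count_pred0 ?addr0 // => j /max.
  by rewrite ltNge => ->; rewrite andbF.
apply: IHs => // [|k ks]; first exact: path_sorted pth.
rewrite fireE //; have [ki|_] := eqVneq k i; first by rewrite -ki ks in iNs.
rewrite subr0; have := ge k; rewrite inE ks orbT => /(_ isT)/le_trans; apply.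
by rewrite -addrA lerD2l -PoszD lez_nat leq_add2r; case: (e k i) => //; case: (_ < _).
Qed.

Lemma indegree_self_reachable (n : nat) (e : rel 'I_n) (h : 'I_n -> int) :
  (0 < n)%N -> simple_graph e -> (forall u v, e u v -> h u != h v) ->
  self_reachable e (indegree e h).
Proof.
move=> n0 [sym irr] hne; pose leh i j := h j <= h i.
have cnt P : count P (sort leh (enum 'I_n)) = (\sum_i P i)%N.
  rewrite count_sort -sum1_count big_enum_cond /= big_mkcond.
  by apply: eq_bigr => i _; case: (P i).
exists (sort leh (enum 'I_n)); split.
- by move/(congr1 size); rewrite size_sort size_enum_ord => n00; rewrite n00 in n0.
- apply: (legal_sorted (h := h)) => //.
  + by rewrite sort_uniq enum_uniq.
  + by apply: sort_sorted => i j; rewrite /leh le_total.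
  (* Without ties, each edge at [i] either is counted in the indegree or leads to a higher
     neighbour. *)
  move=> i _; rewrite cnt mxE -PoszD lez_nat degreeE -big_split leq_sum // => j _.
  have := @hne i j; case: (e i j) => //= /(_ isT).
  by case: ltgtP.
- apply/matrixP => k o; rewrite (ord1 o) foldl_fireE //.
  rewrite count_uniq_mem ?sort_uniq ?enum_uniq //.
  by rewrite mem_sort mem_enum cnt degreeE muln1 subrK.
Qed.

(** * Indegree vectors in the coordinates of the rooted tree *)

Definition ancestor_mx (n : nat) (p : 'I_n -> 'I_n) : 'M[int]_n :=
  \matrix_(v, w) (fconnect p w v)%:R.

(** Column [r] is zero, which keeps [1%:M - child_mx r p] square and invertible. *)
Definition child_mx (n : nat) (r : 'I_n) (p : 'I_n -> 'I_n) : 'M[int]_n :=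
  \matrix_(v, w) ((w != r) && (p w == v))%:R.

(** This is the indegree vector when every edge points to the parent. *)
Definition child_count (n : nat) (r : 'I_n) (p : 'I_n -> 'I_n) : 'cV[int]_n :=
  \col_v \sum_w child_mx r p v w.

Lemma mulmx_child (n m : nat) (r : 'I_n) (p : 'I_n -> 'I_n)
    (M : 'M[int]_(m, n)) i w :
  (M *m child_mx r p) i w = if w == r then 0 else M i (p w).
Proof.
rewrite mxE; have [->|wr] := eqVneq w r.
  by rewrite big1 // => u _; rewrite mxE eqxx mulr0.
rewrite (bigD1 (p w)) //= mxE wr eqxx mulr1 big1 ?addr0 // => u uw.
by rewrite mxE [p w == u]eq_sym (negPf uw) andbF mulr0.
Qed.

(** For [w != r], the ancestors of [w] and of [p w], each vertex counted among its own, differ only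
    by [w] itself. *)
Lemma ancestor_mxK (n : nat) (e : rel 'I_n) r p d :
  rooted_at e r p d -> ancestor_mx p *m (1%:M - child_mx r p) = 1%:M.
Proof.
move=> rt; apply/matrixP => v w; rewrite mulmxBr mulmx1 mxE [X in _ + X]mxE.
rewrite mulmx_child !mxE (rooted_fconnectE _ _ rt).
have [->|wv] := eqVneq w v.
  rewrite /=; have [_|vr] := eqVneq v r; rewrite ?subr0 //.
  by rewrite (rooted_fconnect_parentF rt vr) subr0.
rewrite /= ?[v == w]eq_sym ?(negPf wv).
by case: eqVneq => _; rewrite ?subr0 ?subrr.
Qed.

(** Start with all edges pointing to the parent. Turning the edge between [w] and [p w] moves one
    unit from [p w] to [w], which adds column [w] of [1%:M - child_mx r p]. *)
Lemma indegree_rooted (n : nat) (e : rel 'I_n) r p d (h : 'I_n -> int) :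
  rooted_at e r p d -> (forall u v, e u v -> h u != h v) ->
  indegree e h = child_count r p
    + (1%:M - child_mx r p) *m (\col_w ((w != r) && (h (p w) < h w))%:R).
Proof.
move=> [pr pd eE] hne; apply/matrixP => v o; rewrite (ord1 o) {o}.
rewrite mulmxBl mul1mx !mxE -natz natr_sum.
transitivity (\sum_u (((v != r) && (p v == u) && (h u < h v))%:R
   + (((u != r) && (p u == v) && (h u < h v))%:R : int))).
  apply: eq_bigr => u _; rewrite eE.
  case: (eqVneq (p v) u) => [vu|_]; case: (eqVneq (p u) v) => [uv|_];
    rewrite ?andbF ?andbT ?orbF ?add0r ?addr0 ?andFb //=.
  have [->|vr] /= := eqVneq v r; first by rewrite add0r.
  have [->|ur] /= := eqVneq u r; first by rewrite addr0.
  (* Two vertices cannot be parents of each other, by rank. *)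
  by have := pd _ vr; have := pd _ ur; rewrite uv vu; lia.
rewrite big_split /= addrCA; congr (_ + _).
  rewrite (bigD1 (p v)) //= eqxx andbT big1 ?addr0 // => u upv.
  by rewrite [p v == u]eq_sym (negPf upv) andbF.
rewrite -sumrB; apply: eq_bigr => u _; rewrite !mxE.
have [->|ur] := eqVneq u r; first by rewrite mul0r subr0.
have [uv|_] := eqVneq (p u) v; rewrite /= ?mul0r ?subr0 // uv mul1r.
by have := @hne u v; rewrite eE ur uv eqxx /= => /(_ isT); case: ltgtP.
Qed.

(** The column sums of [1%:M - child_mx r p] vanish except at [r], where the orientation vector is
    0. Only the child counts remain, one unit for each vertex other than [r]. *)
Lemma sum_indegree (n : nat) (e : rel 'I_n) r p d (h : 'I_n -> int) :
  rooted_at e r p d -> (forall u v, e u v -> h u != h v) ->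
  \sum_v indegree e h v 0 = n.-1%:Z.
Proof.
move=> rt hne; rewrite (indegree_rooted rt hne).
have -> : forall c : 'cV[int]_n,
    \sum_v c v 0 = ((const_mx 1 : 'rV[int]_n) *m c) 0 0.
  by move=> c; rewrite mxE; apply: eq_bigr => v _; rewrite mxE mul1r.
rewrite mulmxDr mulmxA [X in _ + X *m _](_ : _ = delta_mx 0 r); last first.
  apply/matrixP => i w.
  rewrite mulmxBr mulmx1 mxE [X in _ + X]mxE mulmx_child !mxE.
  by rewrite ord1 eqxx /=; case: eqVneq; rewrite ?subr0 ?subrr.
rewrite -rowE !mxE eqxx addr0.
under eq_bigr do rewrite !mxE mul1r.
rewrite exchange_big /= (eq_bigr (fun w => (w != r)%:R)) => [|w _].
  by rewrite -natr_sum -big_mkcond sum1_card cardC1 card_ord natz.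
rewrite (bigD1 (p w)) //= mxE eqxx andbT big1 ?addr0 // => v vw.
by rewrite mxE [p w == v]eq_sym (negPf vw) andbF.
Qed.

(* [h] is obtained by summing steps of 1 or -1 along the paths from the root. *)
Lemma orientation_height (n : nat) (e : rel 'I_n) r p d (b : pred 'I_n) :
  rooted_at e r p d ->
  exists h : 'I_n -> int,
    forall w, w != r -> h (p w) != h w /\ (h (p w) < h w) = b w.
Proof.
move=> rt; pose z : 'rV[int]_n := \row_w if b w then 1 else -1.
pose H := z *m ancestor_mx p; exists (H 0) => w wr.
have : (H *m (1%:M - child_mx r p)) 0 w = z 0 w.
  by rewrite -mulmxA (ancestor_mxK rt) mulmx1.
rewrite mulmxBr mulmx1 mxE [X in _ + X]mxE mulmx_child (negPf wr) [z 0 w]mxE.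
by move: (H 0 w) (H 0 (p w)) => x y; case: (b w) => xy; split; lia.
Qed.

Lemma self_reachable_setE (n : nat) (e : rel 'I_n) r p d :
  (0 < n)%N -> is_tree e -> rooted_at e r p d ->
  self_reachable_set e n.-1 =
    [set child_count r p + (1%:M - child_mx r p) *m x
       | x in [set x : 'cV[int]_n | x r 0 = 0 /\ forall i, x i 0 = 0 \/ x i 0 = 1]].
Proof.
move=> n0 [simp conn acyc] rt; have [pr pd eE] := rt.
apply/seteqP; split=> [c [c0 [s [s0 leg fs]] sumc]|c /= [x [xr x01] <-]].
  have alls := recurrent_fires_all simp conn s0 fs.
  pose h i := (index i (rev s))%:Z.
  have hne u v : e u v -> h u != h v.
    (* Vertices absent from [s] would be tied; since all fire, the indices are distinct. *)
    move=> euv; rewrite eqz_nat; apply/eqP => uv.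
    have : u = v by apply: index_inj uv; rewrite ?mem_rev ?alls.
    by move=> uv'; case: simp => _ irr; rewrite uv' irr in euv.
  have cE : c = indegree e h.
    have le v : indegree e h v 0 <= c v 0.
      by rewrite -fs; exact: last_firing_le.
    apply/matrixP => v o; rewrite (ord1 o).
    apply/eqP; rewrite -subr_eq0; apply/eqP.
    (* The differences are nonnegative and sum to 0, both vectors having [n.-1] chips, so each
       vanishes. *)
    have /psumr_eq0P : forall i : 'I_n, true -> 0 <= c i 0 - indegree e h i 0.
      by move=> i _; rewrite subr_ge0.
    by apply=> //; rewrite sumrB sumc (sum_indegree rt hne) subrr.
  rewrite cE (indegree_rooted rt hne) /=.
  eexists; last reflexivity.
  by rewrite mxE eqxx; split=> // i; rewrite mxE; case: (_ && _); [right|left].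
(* Any 0/1 choice on the edges of a tree comes from heights, so the orientation is acyclic. *)
have [h hP] := orientation_height (fun w => x w 0 == 1) rt.
have hne u v : e u v -> h u != h v.
  by rewrite eE => /orP[] /andP[/hP[ne _] /eqP <-] //; rewrite eq_sym.
have -> : x = \col_w ((w != r) && (h (p w) < h w))%:R.
  apply/matrixP => w o; rewrite (ord1 o) !mxE; have [->//|wr] := eqVneq w r.
  by have [_ ->] := hP _ wr; case: (x01 w) => ->.
rewrite -(indegree_rooted rt hne); split.
- by move=> i; rewrite mxE.
- exact: indegree_self_reachable.
- exact: sum_indegree rt hne.
Qed.

(** * Convexity and the vertices of the cube *)

Lemma convex_affine_preimage (R : realType) (n m : nat) (M : 'M[R]_(n, m))
    (b : 'cV[R]_n) (C : set 'cV[R]_n) :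
  convex_set (C : set (convex_lmodType 'cV[R]_n)) ->
  convex_set ([set x | C (M *m x + b)] : set (convex_lmodType 'cV[R]_m)).
Proof.
move=> cC x y t; rewrite !inE /= => Cx Cy.
have := cC _ _ t (mem_set Cx) (mem_set Cy); rewrite inE; congr (C _).
rewrite /conv /= mulmxDr -!scalemxAr !scalerDr addrACA -scalerDl.
by rewrite add_onemK scale1r.
Qed.

Lemma convex_cube (R : realType) (n : nat) :
  convex_set (cube_times_zero R n : set (convex_lmodType 'cV[R]_n)).
Proof.
move=> x y t; rewrite !inE => Cx Cy i; have [Cx1 Cx2] := Cx i.
have [Cy1 Cy2] := Cy i.
rewrite /conv /= !mxE; split=> [ilt|iE]; last first.
  by rewrite Cx2 // Cy2 // !mulr0 addr0.
have /andP[x0 x1] := Cx1 ilt; have /andP[y0 y1] := Cy1 ilt.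
have t0 : 0 <= t%:inum by exact: ge0.
have t1 : 0 <= t%:inum.~ by rewrite onem_ge0 ?le1.
rewrite addr_ge0 ?mulr_ge0 //= -(add_onemK t%:inum) lerD //; exact: ler_piMr.
Qed.

(** The induction is on the list of coordinates still allowed to be fractional: a point lies on the
    segment joining the two points where coordinate [i] is replaced by 0 and by 1. *)
Lemma cube_sub_convex (R : realType) (n : nat) (C : set 'cV[R]_n) :
  convex_set (C : set (convex_lmodType 'cV[R]_n)) ->
  (forall y, cube_times_zero R n y -> (forall i, y i 0 = 0 \/ y i 0 = 1) -> C y) ->
  cube_times_zero R n `<=` C.
Proof.
move=> cC vert y; have : forall i, i \notin enum 'I_n -> y i 0 = 0 \/ y i 0 = 1.
  by move=> i; rewrite mem_enum.
elim: (enum _) y => [|i s IHs] y ys cy; first by apply: vert => // j; exact: ys.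
have [ilt|ige] := boolP (i < n.-1)%N; last first.
  apply: IHs => // j js; have [->|ji] := eqVneq j i; last first.
    by apply: ys; rewrite inE negb_or ji.
  (* Here [i] is the last coordinate, which is already 0. *)
  by left; case: (cy i) => _; apply; have := ltn_ord i; lia.
pose z c : 'cV[R]_n := \col_j if j == i then c else y j 0.
have Cz c : (c = 0 \/ c = 1) -> C (z c).
  move=> c01; apply: IHs => j; last first.
    rewrite mxE; have [->|_] := eqVneq j i; [|exact: (cy j)].
    split=> [_|ij]; last by rewrite ij ltnn in ilt.
    by case: c01 => ->; rewrite ?lexx ?ler01.
  move=> js; rewrite mxE; have [//|ji] := eqVneq j i.
  by apply: ys; rewrite inE negb_or ji.
have [/(_ ilt)/andP[y0 y1] _] := cy i.
(* The weight of [z 1] is [y i 0] itself. *)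
have := cC _ _ (Itv01 y0 y1) (mem_set (Cz 1 (or_intror erefl)))
  (mem_set (Cz 0 (or_introl erefl))).
rewrite inE; congr (C _); apply/matrixP => j o; rewrite (ord1 o) /conv /= !mxE.
have [->|_] := eqVneq j i; first by rewrite mulr1 mulr0 addr0.
by rewrite -mulrDl add_onemK mul1r.
Qed.

Theorem theorem3p4 (R : realType) (n : nat) (e : rel 'I_n)
    (n_ge1 : (1 <= n)%N) (tree_e : is_tree e) :
  exists (U : 'M[int]_n) (b : 'cV[int]_n),
    \det U = 1 /\
    cube_times_zero R n =
      [set map_mx intr U *m x + map_mx intr b
         | x in self_reachable_polytope R e n.-1].
Proof.
have lt_r : (n.-1 < n)%N by rewrite prednK.
(* The root is the last vertex because the last coordinate is the one that vanishes on the cube. *)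
pose r := Ordinal lt_r.
have [p [d rt]] := tree_rooted r tree_e.
have rE (i : 'I_n) : i = n.-1 :> nat <-> i = r by split=> [ir|->//]; exact: val_inj.
pose A := ancestor_mx p; pose B := 1%:M - child_mx r p; pose k := child_count r p.
have AB : A *m B = 1%:M by exact: ancestor_mxK rt.
(* Rescaling the root coordinate, which vanishes on the cube, makes the
   determinant 1. *)
pose D : 'M[int]_n := diag_mx (\row_j if j == r then \det B else 1).
pose U := D *m A; pose b := - (U *m k).
have detU : \det U = 1.
  rewrite det_mulmx det_diag (bigD1 r) //= mxE eqxx big1 ?mulr1.
    by rewrite mulrC -det_mulmx AB det1.
  by move=> i /negPf ir; rewrite mxE ir.
pose toR m1 m2 (M : 'M[int]_(m1, m2)) : 'M[R]_(m1, m2) := map_mx intr M.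
(* Since [U *m B = D] fixes vectors with zero root coordinate and [b] cancels [U *m k], the map
   given by [U] and [b] undoes [y] to [B y + k] on these vectors. *)
have UK (y : 'cV[R]_n) : y r 0 = 0 ->
    toR _ _ U *m (toR _ _ B *m y + toR _ _ k) + toR _ _ b = y.
  have toRM (m : nat) (M : 'M[int]_n) (N : 'M[int]_(n, m)) :
    toR _ _ (M *m N) = toR _ _ M *m toR _ _ N by exact: map_mxM.
  have toRN (m : nat) (N : 'M[int]_(n, m)) : toR _ _ (- N) = - toR _ _ N.
    exact: map_mxN.
  move=> yr; rewrite /b toRN toRM mulmxDr mulmxA addrK -toRM.
  rewrite /U -mulmxA AB mulmx1 /toR map_diag_mx mul_diag_mx; apply/matrixP => i o.
  rewrite (ord1 o) !mxE; have [->|_] := eqVneq i r; first by rewrite yr mulr0.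
  by rewrite mul1r.
have cube_r (y : 'cV[R]_n) : cube_times_zero R n y -> y r 0 = 0.
  by move=> /(_ r)[_]; apply.
exists U, b; split=> //; apply/seteqP; split=> [y Cy|_ [x Px <-]].
  exists (toR _ _ B *m y + toR _ _ k); last by apply: UK; exact: cube_r.
  (* Hull membership is tested on an arbitrary convex [C] containing the configurations; its affine
     preimage is convex, so only the vertices of the cube matter. *)
  move=> C [cC SC].
  apply: (@cube_sub_convex R n [set y | C (toR _ _ B *m y + toR _ _ k)]) Cy.
    exact: convex_affine_preimage.
  move=> z Cz z01; apply: SC => /=.
  pose x : 'cV[int]_n := \col_i (z i 0 == 1)%:R.
  have xz : toR _ _ x = z.
    apply/matrixP => i o; rewrite (ord1 o) !mxE.
    by case: (z01 i) => ->; rewrite ?eqxx // eq_sym oner_eq0.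
  exists (k + B *m x); last by rewrite map_mxD map_mxM /= addrC -xz.
  rewrite (self_reachable_setE n_ge1 tree_e rt); exists x => //=; split=> [|i].
    by rewrite mxE (cube_r _ Cz) eq_sym oner_eq0.
  by rewrite mxE; case: eqP; [right|left].
(* Conversely the preimage of the cube is convex, so by minimality of the hull only the
   configurations need checking. *)
suff /(_ x Px) : self_reachable_polytope R e n.-1 `<=`
    [set x | cube_times_zero R n (toR _ _ U *m x + toR _ _ b)] by [].
apply: smallest_sub; first exact: convex_affine_preimage (@convex_cube R n).
move=> _ [c Sc <-] /=; move: Sc.
rewrite (self_reachable_setE n_ge1 tree_e rt) => -[v [vr v01] <-].
have -> : map_mx intr (k + B *m v) = toR _ _ B *m toR _ _ v + toR _ _ k.
  by rewrite map_mxD map_mxM /= addrC.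
rewrite UK; last by rewrite mxE vr.
move=> i; rewrite mxE; split=> [_|/rE->]; last by rewrite vr.
by case: (v01 i) => ->; rewrite ?lexx ?ler01.
Qed.
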